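(* If a real Banach space $X$ has the Daugavet property, then $X$ has the strong diameter 2 property.
   Context: A Banach space $X$ has the Daugavet property if $\|I+T\|=1+\|T\|$ for every bounded rank one operator $T:X\to X$, where $I$ is the identity operator on $X$. Let $B_X$ be the closed unit ball and $S_{X^*}$ the unit sphere of the dual $X^*$. A slice of $B_X$ is a set $S(x^*,\varepsilon)=\{x\in B_X: x^*(x)>1-\varepsilon\}$ with $x^*\in S_{X^*}$, $\varepsilon>0$. A finite convex combination of slices is a set $\sum_{i=1}^n\lambda_iS(x_i^*,\varepsilon_i)=\{\sum_{i=1}^n\lambda_ix_i: x_i\in S(x_i^*,\varepsilon_i)\}$ with $n\ge1$, $\lambda_i\ge0$, $\sum_{i=1}^n\lambda_i=1$, $x_i^*\in S_{X^*}$, $\varepsilon_i>0$. $X$ has the strong diameter 2 property if every finite convex combination of slices of $B_X$ has diameter 2. *)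

(* Defs.v *)
From HB Require Import structures.
From mathcomp Require Import all_boot all_order all_algebra.
From mathcomp Require Import all_classical all_reals all_analysis.

Set Implicit Arguments.
Unset Strict Implicit.
Unset Printing Implicit Defensive.

Import Order.TTheory GRing.Theory Num.Theory.
Import numFieldNormedType.Exports.

Local Open Scope classical_set_scope.
Local Open Scope ring_scope.

Definition unit_ball (R : realType) (X : normedModType R) : set X :=
  [set x | `|x| <= 1].

Arguments unit_ball {R} X.

(* [sup] is a real supremum, equal to 0 by convention on unbounded sets, so
   [opnorm f] is meaningful only when f is bounded on the unit ball. *)
Definition opnorm (R : realType) (X Y : normedModType R) (f : X -> Y) : R :=
  sup [set `|f x| | x in unit_ball X].

(* The range is exactly a line, so the zero operator is excluded; in
   particular there is no rank one operator on the zero space. *)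
Definition rank_one (R : realType) (X Y : normedModType R)
    (T : {linear X -> Y}) : Prop :=
  exists2 v : Y, v != 0 & range T = [set a *: v | a in [set: R]].

Definition daugavet (R : realType) (X : normedModType R) : Prop :=
  forall T : {linear X -> X}, bounded_fun_norm T -> rank_one T ->
    opnorm (fun x => x + T x) = 1 + opnorm T.

Definition dual_sphere (R : realType) (X : normedModType R) :
    set {linear X -> R^o} :=
  [set f : {linear X -> R^o} | bounded_fun_norm f /\ opnorm f = 1].

Arguments dual_sphere {R} X.

Definition slice (R : realType) (X : normedModType R)
    (f : {linear X -> R^o}) (e : R) : set X :=
  [set x | unit_ball X x /\ f x > 1 - e].

Definition convex_combination (R : realType) (X : normedModType R) (n : nat)
    (l : 'I_n -> R) (A : 'I_n -> set X) : set X :=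
  [set \sum_(i < n) l i *: x i | x in [set x : 'I_n -> X | forall i, A i (x i)]].

Definition diameter (R : realType) (X : normedModType R) (A : set X) : \bar R :=
  ereal_sup [set (`|p.1 - p.2|)%:E | p in A `*` A].

Definition strong_diameter2 (R : realType) (X : normedModType R) : Prop :=
  forall (n : nat) (l : 'I_n -> R) (f : 'I_n -> {linear X -> R^o})
      (e : 'I_n -> R),
    (0 < n)%N ->
    (forall i, 0 <= l i) -> \sum_(i < n) l i = 1 ->
    (forall i, dual_sphere X (f i)) -> (forall i, 0 < e i) ->
    diameter (convex_combination l (fun i => slice (f i) (e i))) = 2%:E.

(* Main.v *)
From HB Require Import structures.
Require Import Defs.
From mathcomp Require Import all_boot all_order all_algebra.
From mathcomp Require Import all_classical all_reals all_analysis.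
From mathcomp Require Import lra.

(** A norm-one functional [f] and a unit vector [u] give the rank one operator
    [f (x) u] of norm one, so the Daugavet equation provides [x] in any given
    slice of [f] with [`|u + x|] close to 2. By the triangle inequality
    [`|s u + t x|] is then close to [s + t] for all [s, t >= 0]. Adding the
    vectors [l i *: x i] and then [- (l i *: x' i)] one at a time, each chosen
    in its slice so that the norm grows by almost [l i], gives two points of
    the convex combination whose distance is almost [1 + 1]. *)

Set Implicit Arguments.
Unset Strict Implicit.
Unset Printing Implicit Defensive.

Import Order.TTheory GRing.Theory Num.Theory.
Import numFieldNormedType.Exports.

Local Open Scope classical_set_scope.
Local Open Scope ring_scope.

Definition rank_one_map (R : realType) (X Y : normedModType R)
  (f : {linear X -> R^o}) (v : Y) (x : X) : Y := (f x : R) *: v.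

Lemma rank_one_map_linear (R : realType) (X Y : normedModType R)
  (f : {linear X -> R^o}) (v : Y) : linear (rank_one_map f v).
Proof.
by move=> a x y; rewrite /rank_one_map linearP scalerDl scalerA.
Qed.

HB.instance Definition _ (R : realType) (X Y : normedModType R)
    (f : {linear X -> R^o}) (v : Y) :=
  GRing.isLinear.Build R X Y _ (rank_one_map f v) (rank_one_map_linear f v).

(** This excludes the default value of [sup]: the set contains [|g 0|], and boundedness is used at
    radius 1. *)
Lemma opnorm_has_sup (R : realType) (X Y : normedModType R) (g : X -> Y) :
  bounded_fun_norm g -> has_sup [set `|g x| | x in unit_ball X].
Proof.
move=> /(_ 1)[M gM]; split; last by exists M => _ [x x1 <-]; exact: gM.
by exists `|g 0|, 0 => //=; rewrite /unit_ball/= normr0.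
Qed.

Lemma opnorm_ub (R : realType) (X Y : normedModType R) (g : X -> Y) (x : X) :
  bounded_fun_norm g -> `|x| <= 1 -> `|g x| <= opnorm g.
Proof.
by move=> gb x1; apply: sup_upper_bound; [exact: opnorm_has_sup|exists x].
Qed.

Lemma opnorm_adherent (R : realType) (X Y : normedModType R) (g : X -> Y)
    (d : R) :
  bounded_fun_norm g -> 0 < d ->
  exists2 x, `|x| <= 1 & opnorm g - d < `|g x|.
Proof.
move=> gb d0; have [_ [x x1 <-] h] := sup_adherent d0 (opnorm_has_sup gb).
by exists x.
Qed.

Lemma dual_sphere_neq0 (R : realType) (X : normedModType R)
  (f : {linear X -> R^o}) : dual_sphere X f -> exists x, f x != 0.
Proof.
move=> [fb f1]; have [x _] := opnorm_adherent fb (ltr01 : 0 < 1 :> R).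
by rewrite f1 subrr normr_gt0 => fx0; exists x.
Qed.

Lemma rank_one_map_bounded (R : realType) (X Y : normedModType R)
    (f : {linear X -> R^o}) (v : Y) :
  bounded_fun_norm f -> bounded_fun_norm (rank_one_map f v).
Proof.
move=> fb r; have [M fM] := fb r; exists (M * `|v|) => x xr.
by rewrite normrZ ler_wpM2r//; exact: fM.
Qed.

Lemma rank_one_mapP (R : realType) (X Y : normedModType R)
    (f : {linear X -> R^o}) (v : Y) (x : X) :
  v != 0 -> f x != 0 -> rank_one (rank_one_map f v).
Proof.
move=> v0 fx0; exists v => //; apply/seteqP; split => [_ [z _ <-]|_ [a _ <-]].
  by exists (f z).
exists ((a / f x) *: x) => //.
by rewrite /= /rank_one_map linearZ/= /GRing.scale/= divfK.
Qed.

Lemma opnorm_rank_one_map (R : realType) (X Y : normedModType R)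
    (f : {linear X -> R^o}) (v : Y) :
  `|v| = 1 -> opnorm (rank_one_map f v) = opnorm f.
Proof.
move=> v1; congr sup; apply/seteqP; split => _ [x x1 <-]; exists x => //=;
  by rewrite normrZ v1 mulr1.
Qed.

(** If [x] almost attains the norm 2 of [I + T], then [|T x| = |f x|] is close to 1. Once [f x] is
    nonnegative, [x] lies in the slice and [T x] is close to [u]. *)
Lemma daugavet_slice (R : realType) (X : normedModType R)
    (f : {linear X -> R^o}) (u : X) (e d : R) :
  daugavet X -> dual_sphere X f -> `|u| = 1 -> 0 < e -> 0 < d ->
  exists2 x, slice f e x & 2 - d <= `|u + x|.
Proof.
move=> dX fS u1 e0 d0; have [fb f1] := fS.
have [z fz0] := dual_sphere_neq0 fS.
have u0 : u != 0 by rewrite -normr_gt0 u1.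
pose T : {linear X -> X} := rank_one_map f u.
have Tb : bounded_fun_norm T by exact: rank_one_map_bounded.
have ITb : bounded_fun_norm (fun x => x + T x).
  move=> r; have [M TM] := Tb r; exists (r + M) => x xr.
  by rewrite (le_trans (ler_normD _ _))// lerD// TM.
have opT2 : opnorm (fun x => x + T x) = 1 + 1.
  by rewrite dX//; [rewrite opnorm_rank_one_map// f1|exact: rank_one_mapP fz0].
(* The bound by [e] puts [x] in the slice. The bound by [d / 2] is spent twice: on the norm of
   [x + T x], and on replacing [T x] by [u], which costs [1 - f x]. *)
have m0 : 0 < Num.min e (d / 2) by rewrite lt_min e0 divr_gt0.
have [x0 x01] := opnorm_adherent ITb m0; rewrite opT2 => x0T.
(* Replacing x0 by -x0 does not change the norm of x0 + T x0. *)
have [x [x1 fx0 xT]] : exists x, [/\ `|x| <= 1, 0 <= (f x : R) &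
    1 + 1 - Num.min e (d / 2) < `|x + T x|].
  have [fx0|/ltW fx0] := leP 0 (f x0 : R); first by exists x0.
  by exists (- x0); split; rewrite ?normrN// ?linearN ?oppr_ge0// -opprD normrN.
have fx1 : (f x : R) <= 1.
  by have := opnorm_ub fb x1; rewrite f1; exact/le_trans/ler_norm.
have Tx : `|T x| = f x by rewrite normrZ u1 mulr1 ger0_norm.
have := ler_normD x (T x); rewrite Tx => xTx.
have [me md] : Num.min e (d / 2) <= e /\ Num.min e (d / 2) <= d / 2.
  by split; rewrite ge_min lexx ?orbT.
exists x; first by split => //; lra.
have : `|x + T x| <= `|u + x| + `|(1 - f x : R) *: u|.
  rewrite (le_trans _ (ler_normB _ _))// /T/= /rank_one_map scalerBl scale1r.
  by rewrite opprB [u + x]addrC [_ - u]addrC addrA addrK.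
rewrite normrZ u1 mulr1 ger0_norm ?subr_ge0// => ?; lra.
Qed.

(** For [s <= t], write [s u + t x = t (u + x) - (t - s) u]; its norm is at least
    [t (2 - d) - (t - s) = s + t - d t]. *)
Lemma norm_addZ_ge (R : realType) (X : normedModType R) (u x : X) (d s t : R) :
  `|u| <= 1 -> `|x| <= 1 -> 0 <= d -> 2 - d <= `|u + x| -> 0 <= s -> 0 <= t ->
  s + t - d * (s + t) <= `|s *: u + t *: x|.
Proof.
wlog st : u x s t / s <= t => [hw u1 x1 d0 ux s0 t0|].
  have [st|/ltW ts] := leP s t; first exact: hw.
  by rewrite [s + t]addrC [_ + t *: x]addrC; apply: hw => //; rewrite [x + u]addrC.
move=> u1 x1 d0 ux s0 t0.
have : `|t *: (u + x)| <= `|s *: u + t *: x| + `|(t - s) *: u|.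
  by rewrite (le_trans _ (ler_normD _ _))// addrAC -scalerDl subrKC scalerDr.
rewrite !normrZ !ger0_norm ?subr_ge0// => h; nra.
Qed.

Lemma daugavet_slice_scaled (R : realType) (X : normedModType R)
    (f : {linear X -> R^o}) (y : X) (c e d : R) :
  daugavet X -> dual_sphere X f -> 0 < e -> 0 < d ->
  exists2 x, slice f e x & `|y| + `|c| - d <= `|y + c *: x|.
Proof.
move=> dX fS e0 d0.
(* A slice is not symmetric, so the sign is moved from [c] to [y]: [- y + (- c) x] and [y + c x]
   have the same norm. *)
wlog c0 : y c / 0 <= c => [hw|].
  have [/hw|/ltW c0] := leP 0 c; first exact.
  have [|x xS] := hw (- y) (- c); first by rewrite oppr_ge0.
  by rewrite !normrN scaleNr -opprD normrN => h; exists x.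
have [u u1 yu] : exists2 u : X, `|u| = 1 & y = `|y| *: u.
  have normalized (w : X) : w != 0 -> `| `|w|^-1 *: w| = 1.
    by move=> w0; rewrite normrZ normfV normr_id mulVf ?normr_eq0.
  (* For [y = 0] any unit vector serves, and one exists because [f] is nonzero. *)
  have [->|y0] := eqVneq y 0.
    have [w fw0] := dual_sphere_neq0 fS.
    have w0 : w != 0 by apply: contraNneq fw0 => ->; rewrite linear0.
    by exists (`|w|^-1 *: w); rewrite ?normr0 ?scale0r ?normalized.
  exists (`|y|^-1 *: y); first exact: normalized.
  by rewrite scalerA divff ?normr_eq0// scale1r.
have yc0 : 0 <= `|y| + c by rewrite addr_ge0.
have yc1 : 0 < `|y| + c + 1 by lra.
(* The error will be [d' * (|y| + c)], at most [d]; the added 1 keeps the denominator positive when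
   [y] and [c] vanish. *)
pose d' := d / (`|y| + c + 1).
have d'0 : 0 < d' by rewrite divr_gt0.
have [x xS ux] := daugavet_slice dX fS u1 e0 d'0.
exists x => //; rewrite [in leRHS]yu ger0_norm//.
have ule1 : `|u| <= 1 by rewrite u1.
have := norm_addZ_ge ule1 xS.1 (ltW d'0) ux (normr_ge0 y) c0.
apply: le_trans; rewrite lerD2l lerN2.
have -> : d = d' * (`|y| + c + 1) by rewrite divfK// gt_eqF.
by rewrite ler_pM2l// lerDl.
Qed.

Lemma daugavet_slices_sum (R : realType) (X : normedModType R) (n : nat)
    (f : 'I_n -> {linear X -> R^o}) (c e : 'I_n -> R) (y : X) (d : R) :
  daugavet X -> (forall i, dual_sphere X (f i)) -> (forall i, 0 < e i) ->
  0 < d ->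
  exists2 x : 'I_n -> X, (forall i, slice (f i) (e i) (x i)) &
    `|y| + \sum_(i < n) `|c i| - d <= `|y + \sum_(i < n) c i *: x i|.
Proof.
move=> dX; elim: n f c e y d => [|n IH] f c e y d fS e0 d0.
  by exists (fun=> 0) => [[]//|]; rewrite !big_ord0 !addr0 gerBl ltW.
(* Half of [d] pays for the first slice, half for the induction hypothesis, in which [y] has
   absorbed the first term. *)
have d20 : 0 < d / 2 by rewrite divr_gt0.
have [x0 x0S h0] := daugavet_slice_scaled y (c ord0) dX (fS ord0) (e0 ord0) d20.
have [x xS h] := IH (fun i => f (lift ord0 i)) (fun i => c (lift ord0 i))
  (fun i => e (lift ord0 i)) (y + c ord0 *: x0) _
  (fun i => fS (lift ord0 i)) (fun i => e0 (lift ord0 i)) d20.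
exists (fun i => if unlift ord0 i is Some j then x j else x0).
  by move=> i; case: unliftP => [j ->|->].
rewrite !big_ord_recl unlift_none !addrA.
under [X in _ + c ord0 *: x0 + X]eq_bigr do rewrite liftK.
lra.
Qed.

Lemma unit_ball_convex_combination (R : realType) (X : normedModType R)
    (n : nat) (l : 'I_n -> R) (x : 'I_n -> X) :
  (forall i, 0 <= l i) -> \sum_(i < n) l i = 1 ->
  (forall i, `|x i| <= 1) -> `|\sum_(i < n) l i *: x i| <= 1.
Proof.
move=> l0 l1 x1; rewrite -l1 (le_trans (ler_norm_sum _ _ _))//.
by apply: ler_sum => i _; rewrite normrZ ger0_norm// ler_piMr.
Qed.

Theorem theorem4p4 (R : realType) (X : completeNormedModType R) :
  daugavet X -> strong_diameter2 X.
Proof.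
move=> dX n l f e _ l0 l1 fS e0; apply/eqP; rewrite eq_le; apply/andP; split.
  (* Both points are convex combinations of vectors of the unit ball. *)
  apply: ge_ereal_sup => _ [[_ _] [[x xS <-] [x' x'S <-]] <-] /=.
  rewrite lee_fin (le_trans (ler_normB _ _))// [leRHS](_ : 2 = 1 + 1)//.
  apply: lerD; apply: unit_ball_convex_combination => // i;
    [exact: (xS i).1 | exact: (x'S i).1].
(* Two points at distance at least [2 - d] suffice: starting from 0, the coefficients [l i] give
   norm at least [1 - d / 2], and the coefficients [- l i] then add at least as much again. *)
apply/lee_subgt0Pr => d d0; have d20 : 0 < d / 2 by rewrite divr_gt0.
have [x xS] := daugavet_slices_sum l 0 dX fS e0 d20.
rewrite normr0 !add0r => hx.
have [x' x'S] := daugavet_slices_sum (fun i => - l i)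
  (\sum_(i < n) l i *: x i) dX fS e0 d20.
under [X in _ <= `|_ + X|]eq_bigr do rewrite scaleNr.
rewrite sumrN.
have absl1 : \sum_(i < n) `|l i| = 1.
  by rewrite -l1; apply: eq_bigr => i _; rewrite ger0_norm.
rewrite absl1 in hx.
under [X in _ + X - _ <= _]eq_bigr do rewrite normrN.
rewrite absl1 => hx'.
apply: (@le_trans _ _
  (`|\sum_(i < n) l i *: x i - \sum_(i < n) l i *: x' i|)%:E).
  by rewrite -EFinB lee_fin; lra.
apply: ereal_sup_ubound.
exists (\sum_(i < n) l i *: x i, \sum_(i < n) l i *: x' i) => //.
by split; [exists x | exists x'].
Qed.
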